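(* For any $n\ge3$ there is $A\in\Omega_n$ such that $C_A\subsetneq C^*_A$.
   Context: $\mathcal M_n$ is the set of all $n\times n$ complex matrices (identified with $\mathbb C^{n^2}$) and $I\in\mathcal M_n$ the identity matrix. For $A\in\mathcal M_n$, $sp(A)$ is the spectrum (set of eigenvalues) of $A$ and $r(A)=\max_{\lambda\in sp(A)}|\lambda|$ its spectral radius. The spectral ball is $\Omega_n:=\{A\in\mathcal M_n: r(A)<1\}$. For $A\in\Omega_n$, the isospectral variety is $L_A:=\{C\in\Omega_n: sp(C)=sp(A)\}$, and $C_A$ is the tangent cone to $L_A$ at $A$: $C_A$ is the set of all $B\in\mathcal M_n$ for which there exist matrices $C_j\in L_A$ with $C_j\to A$ and real numbers $c_j>0$ ($j=1,2,\dots$) such that $c_j(C_j-A)\to B$ as $j\to\infty$. The functions $\sigma_j:\mathcal M_n\to\mathbb C$ are defined by $\det(tI-A)=t^n+\sum_{j=1}^n(-1)^j\sigma_j(A)t^{n-j}$. For a nonconstant function $g$ holomorphic near $A$, $g_A^*$ denotes the homogeneous polynomial of lowest nonzero degree in the Taylor expansion of $g$ at $A$, i.e. $g(X)-g(A)=g_A^*(X-A)+(\text{terms of higher order})$ with $g^*_A\not\equiv0$. Set $$C^\ast_A:=\{B\in\mathcal M_n:(\sigma_1)_A^*(B)=0,\dots,(\sigma_n)_A^*(B)=0\}.$$ *)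

(* Defs.v *)
From HB Require Import structures.
From mathcomp Require Import all_boot all_order all_algebra.
From mathcomp Require Import complex.
From mathcomp Require Import all_classical all_reals all_analysis.

Set Implicit Arguments.
Unset Strict Implicit.
Unset Printing Implicit Defensive.

Import Order.TTheory GRing.Theory Num.Theory.
Import numFieldNormedType.Exports.

Local Open Scope classical_set_scope.
Local Open Scope ring_scope.
Local Open Scope complex_scope.

(* The analysis library equips every [numFieldType] with its norm topology.
   Seeing [R[i]] through [numFieldType] makes this structure available on the
   complex numbers and on complex matrices. *)
Definition Cplx (R : realType) : numFieldType := R[i].

Section SpectralBall.
Context {R : realType} {n : nat}.
Local Notation C := (Cplx R).
Local Notation M := 'M[C]_n.
Implicit Types A B X : M.

Definition sp A : set C := [set l | eigenvalue A l].

Definition spectral_radius A : R :=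
  sup [set ComplexField.Normc.normc (l : R[i]) | l in sp A].

Definition spectral_ball : set M := [set A | spectral_radius A < 1].

Definition isospectral A : set M := [set X | spectral_ball X /\ sp X = sp A].

Definition tangent_cone A : set M :=
  [set B | exists (X : nat -> M) (c : nat -> R),
    [/\ forall j, isospectral A (X j),
        X @ \oo --> A,
        forall j, 0 < c j
      & (fun j => ((c j)%:C : C) *: (X j - A)) @ \oo --> B]].

(* [char_poly A] is [\det ('X%:M - A)], and [sigma j A] is (-1)^j times its
   coefficient of degree n - j; only 1 <= j <= n is meaningful. *)
Definition sigma (j : nat) A : C := (-1) ^+ j * (char_poly A)`_(n - j).

(* The homogeneous part of degree k of the Taylor expansion of g at A,
   evaluated at B: the coefficient of t^k in the expansion of t |-> g (A + tB)
   at t = 0. *)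
Definition taylor_part (g : M -> C) A (k : nat) B : C :=
  derive1n k (fun t : C => g (A + t *: B)) 0 / k`!%:R.

Definition is_taylor_order (g : M -> C) A (k : nat) : Prop :=
  [/\ (0 < k)%N,
      exists B, taylor_part g A k B != 0
    & forall m, (0 < m < k)%N -> forall B, taylor_part g A m B = 0].

(* If g is constant near A, no order exists and the value is junk. *)
Definition lowest_part (g : M -> C) A : M -> C :=
  taylor_part g A (xget 0%N [set k | is_taylor_order g A k]).

Definition Cstar A : set M :=
  [set B | forall j, (1 <= j <= n)%N -> lowest_part (sigma j) A B = 0].

End SpectralBall.

(* Main.v *)
(* At a nonzero scalar matrix A = aI the differential of every sigma_j is a
   nonzero multiple of the trace, so the cone Cstar A is the whole hyperplane
   tr B = 0.  A matrix with spectrum {a} is aI plus a nilpotent matrix, and a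
   limit B of nilpotent matrices also satisfies tr (B^2) = 0, which fails for
   B = diag(1, -1, 0, ..., 0). *)
Require Import Defs.
From mathcomp Require Import all_boot all_order all_algebra.
From mathcomp Require Import complex.
From mathcomp Require Import all_classical all_reals all_analysis.
Import Order.TTheory GRing.Theory Num.Theory.
Import numFieldNormedType.Exports.

Local Open Scope classical_set_scope.
Local Open Scope ring_scope.

Lemma coef_XsubC_exp (F : comNzRingType) (a : F) (m i : nat) :
  (('X - a%:P) ^+ m)`_i = (- a) ^+ (m - i) *+ 'C(m, i).
Proof.
rewrite addrC -polyCN exprDn coef_sum.
under eq_bigr => k _ do rewrite coefMn -polyC_exp coefCM coefXn.
have [ltim|leim] := ltnP i m.+1; last first.
  rewrite bin_small // mulr0n big1 // => k _.
  by rewrite gtn_eqF ?mulr0 ?mul0rn // (leq_trans (ltn_ord k)).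
rewrite (bigD1 (Ordinal ltim)) //= eqxx mulr1 big1 ?addr0 // => k ki.
by rewrite -val_eqE /= eq_sym in ki; rewrite (negbTE ki) mulr0 mul0rn.
Qed.

(** For [t != 0] this is the expansion of [t ^+ n] times the characteristic polynomial of [B] at
    [('X - a%:P) / t]. It makes each [sigma j] polynomial in [t] along a line through [a%:M]. *)
Lemma char_poly_affine (F : fieldType) (n : nat) (a t : F) (B : 'M[F]_n) :
  char_poly (a%:M + t *: B) =
  \sum_(k < n.+1) ((char_poly B)`_k * t ^+ (n - k)) *: ('X - a%:P) ^+ k.
Proof.
(* At [t = 0] only the term [k = n] survives, as [0 ^+ 0 = 1]. *)
have [->|t0] := eqVneq t 0.
  rewrite scale0r addr0 big_ord_recr /= big1 => [|k _]; last first.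
    by rewrite expr0n subn_eq0 leqNgt ltn_ord mulr0 scale0r.
  rewrite add0r subnn mulr1.
  have /monicP := char_poly_monic B; rewrite /lead_coef size_char_poly /= => ->.
  rewrite scale1r char_poly_trig ?scalar_mx_is_trig //.
  under eq_bigr => i _ do rewrite mxE eqxx mulr1n.
  by rewrite prodr_const card_ord.
(* A factor [t] is taken out of each of the [n] rows of the determinant. *)
have -> : char_poly (a%:M + t *: B) =
    t%:P ^+ n * (char_poly B \Po (t^-1 *: ('X - a%:P))).
  rewrite -det_map_mx -detZ; congr (\det _).
  apply/matrixP => i j; rewrite !mxE rmorphB rmorphMn /= comp_polyC comp_polyX.
  rewrite mulrBr mulrnAr mul_polyC scalerA mulfV // scale1r.
  by rewrite polyCD polyCM polyCMn mulrnBl opprD addrA.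
rewrite comp_polyE size_char_poly mulr_sumr; apply: eq_bigr => k _.
rewrite -polyC_exp mul_polyC exprZn !scalerA; congr (_ *: _).
rewrite mulrAC exprVn -expfB_cond 1?mulrC // (negbTE t0).
exact: ltn_ord k.
Qed.

(** The characteristic polynomial splits with all roots 0, so it is a power of ['X]; the trace is
    minus its subleading coefficient. *)
Lemma mxtrace_eigenvalue0 (F : closedFieldType) (n : nat) (N : 'M[F]_n) :
  (forall l, eigenvalue N l -> l = 0) -> \tr N = 0.
Proof.
case: n N => [|n] N N0; first by rewrite /mxtrace big_ord0.
apply: oppr_inj; rewrite oppr0 -char_poly_trace //=.
have [r rE] := closed_field_poly_normal (char_poly N).
have r0 : forall z, z \in r -> z = 0.
  move=> z zr; apply: N0; rewrite eigenvalue_root_char rE /root hornerZ.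
  by rewrite (eqP (_ : root _ _)) ?mulr0 // root_prod_XsubC.
have {}rE : char_poly N = 'X^(size r).
  rewrite rE (monicP (char_poly_monic N)) scale1r.
  rewrite (eq_big_seq (fun _ => 'X)) => [|z /r0 ->]; last by rewrite subr0.
  by rewrite big_const_seq count_predT iter_mulr_1.
have := size_char_poly N; rewrite rE size_polyXn => -[->].
by rewrite coefXn ltn_eqF.
Qed.

(* If v N^2 = m^2 v, then w = v N + m v satisfies w N = m w: either w is an
   eigenvector for m, or w = 0 and v is one for -m. *)
Lemma eigenvalue_sqr0 (F : numClosedFieldType) (n : nat) (N : 'M[F]_n) :
  (forall l, eigenvalue N l -> l = 0) ->
  forall l, eigenvalue (N *m N) l -> l = 0.
Proof.
move=> N0 l /eigenvalueP[v vl v0]; rewrite -(sqrtCK l); set m := sqrtC l.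
suff -> : m = 0 by rewrite expr0n.
have [w0|w0] := eqVneq (v *m N + m *: v) 0.
  apply/eqP; rewrite -oppr_eq0; apply/eqP/N0/eigenvalueP; exists v => //.
  by apply/eqP; rewrite scaleNr -addr_eq0 w0.
apply: N0; apply/eigenvalueP; exists (v *m N + m *: v) => //.
by rewrite mulmxDl -mulmxA vl scalerDr scalerA -expr2 sqrtCK addrC scalemxAl.
Qed.

Lemma mxtrace_delta (F : nzRingType) (n : nat) (i j : 'I_n) :
  \tr (delta_mx i j : 'M[F]_n) = (i == j)%:R.
Proof.
rewrite /mxtrace (bigD1 i) //= mxE eqxx big1 ?addr0 // => k ki.
by rewrite mxE (negbTE ki).
Qed.

(* The library has this only over a [realFieldType], which excludes [Cplx R]. *)
Lemma derivable_derive1_horner (K : numFieldType) (p : {poly K}) (x : K) :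
  derivable (horner p : K -> K) x 1 /\ derive1 (horner p : K -> K) x = p^`().[x].
Proof.
elim/poly_ind: p => [|p c [dp ih]].
  have -> : horner (0 : {poly K}) = cst 0 by apply/funext => y; rewrite horner0.
  by rewrite derive1_cst deriv0 horner0; split=> //; exact: derivable_cst.
have -> : horner (p * 'X + c%:P) = (horner p : K -> K) * id + cst c.
  by apply/funext => y; rewrite hornerMXaddC.
have dpX : derivable ((horner p : K -> K) * id) x 1 by apply: derivableM.
split; first by apply: derivableD.
rewrite derive1E deriveD // derive_cst addr0 deriveM // derive_id -derive1E ih.
by rewrite derivD derivC addr0 derivM derivX mulr1 hornerD hornerMX addrC
  -[_ *: 1]/(_ * 1) mulr1 mulrC.
Qed.

Section ScalarMatrix.
Context {R : realType} {n : nat}.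
Local Notation C := (Cplx R).
Local Notation M := 'M[C]_n.
Implicit Types (a : C) (B : M).

Lemma taylor_part_sigma a B (j : nat) : (1 <= j <= n)%N ->
  taylor_part (sigma j) a%:M 1 B = a ^+ j.-1 *+ 'C(n.-1, j.-1) * \tr B.
Proof.
move=> /andP[j1 jn]; have n0 : (0 < n)%N by apply: leq_trans jn.
pose p : {poly C} := \sum_(k < n.+1) ((-1) ^+ j * (char_poly B)`_k *
  (('X - a%:P) ^+ k)`_(n - j)) *: 'X^(n - k).
rewrite /taylor_part divr1.
have -> : (fun t : C => sigma j (a%:M + t *: B)) = horner p.
  apply/funext => t; rewrite /sigma char_poly_affine coef_sum mulr_sumr.
  rewrite horner_sum; apply: eq_bigr => k _.
  by rewrite coefZ hornerZ hornerXn !mulrA mulrAC.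
rewrite derive1n1 (derivable_derive1_horner C p 0).2 horner_coef0 coef_deriv mulr1n.
have ltn1 : (n.-1 < n.+1)%N by rewrite prednK.
(* The coefficient of [t] comes from [k = n.-1] alone, where [char_poly B] has coefficient
   [- \tr B]. *)
rewrite coef_sum (bigD1 (Ordinal ltn1)) //= big1 => [|k].
  have -> : (n - n.-1 = 1)%N by rewrite -{1}(prednK n0) subSnn.
  rewrite addr0 coefZ coefXn mulr1 char_poly_trace //.
  rewrite coef_XsubC_exp.
  have jn1 : (j.-1 <= n.-1)%N by rewrite -!subn1 leq_sub2r.
  have -> : (n - j = n.-1 - j.-1)%N.
    by rewrite -{1}(prednK n0) -{1}(prednK j1) subSS.
  rewrite subKn // bin_sub //.
  (* The signs cancel: [(-1) ^+ j] from [sigma], [(-1) ^+ j.-1] from the power of [- a], and the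
     minus sign of the trace coefficient. *)
  rewrite (exprNn a) -{1}(prednK j1) exprS mulN1r mulrNN -mulrnAr mulrACA.
  by rewrite -expr2 sqrr_sign mul1r mulrC.
rewrite -val_eqE /= => kn; rewrite coefZ coefXn eq_sym.
have [nk|] := eqVneq (n - k)%N 1%N; last by rewrite mulr0.
by move: kn; rewrite -subn1 -nk subKn ?eqxx // -ltnS.
Qed.

(** Since [a != 0] in characteristic 0, the factor of [\tr B] in the linear part is nonzero, so the
    Taylor order is 1. *)
Lemma lowest_part_sigma a B (j : nat) : a != 0 -> (1 <= j <= n)%N ->
  (lowest_part (sigma j) a%:M B == 0) = (\tr B == 0).
Proof.
move=> a0 jn; have /andP[j1 j_n] := jn.
have K0 : a ^+ j.-1 *+ 'C(n.-1, j.-1) != 0.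
  rewrite -mulr_natr mulf_neq0 ?expf_neq0 // pnatr_eq0 -lt0n bin_gt0.
  by rewrite -!subn1 leq_sub2r.
have order1 : is_taylor_order (sigma j) (a%:M : M) 1.
  split=> //; last by move=> m /andP[/leq_trans h /h]; rewrite ltnn.
  exists 1%:M; rewrite taylor_part_sigma // mulf_neq0 // mxtrace1 pnatr_eq0.
  by rewrite -lt0n (leq_trans j1).
rewrite /lowest_part; case: xgetP => [k _ [k0 _ kmin]|/(_ 1%N)//].
(* An order above 1 would force the linear part to vanish identically. *)
have -> : k = 1%N.
  apply/eqP; rewrite eqn_leq k0 andbT leqNgt; apply/negP => k1.
  by have [_ [B0 /negP[]]] := order1; rewrite kmin.
by rewrite taylor_part_sigma // mulf_eq0 (negbTE K0).
Qed.

Lemma sp_scalar a : (0 < n)%N -> sp (a%:M : M) = [set a].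
Proof.
case: n => // m _; apply/seteqP; split=> l /=.
  move=> /eigenvalueP[v]; rewrite mul_mx_scalar => /eqP.
  rewrite -subr_eq0 -scalerBl scaler_eq0 subr_eq0 => /orP[/eqP->//|/eqP->].
  by rewrite eqxx.
move=> ->; apply/eigenvalueP; exists (const_mx 1); first by rewrite mul_mx_scalar.
by apply/eqP => /matrixP/(_ 0 0)/eqP; rewrite !mxE oner_eq0.
Qed.

Lemma mxtrace_continuous : continuous (fun X : M => \tr X).
Proof.
apply: (@continuous_big C _ +%R); first exact: add_continuous.
by move=> i _; exact: coord_continuous.
Qed.

Lemma mxtrace_sqr_continuous : continuous (fun X : M => \tr (X *m X)).
Proof.
apply: (@continuous_big C _ +%R) => [|i _]; first exact: add_continuous.
have -> : (fun X : M => (X *m X) i i) = (fun X => \sum_j X i j * X j i).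
  by apply/funext => X; rewrite mxE.
apply: (@continuous_big C _ +%R) => [|j _]; first exact: add_continuous.
by move=> X; apply: cvgM; [exact: nbhs_filter|exact: coord_continuous..].
Qed.

(** An eigenvalue [l] of the rescaled difference gives the eigenvalue [a + c^-1 * l] of [X], which
    must be [a]. *)
Lemma eigenvalue_scaled_shift a c (X : M) : c != 0 -> sp X = [set a] ->
  forall l, eigenvalue (c *: (X - a%:M)) l -> l = 0.
Proof.
move=> c0 Xa l /eigenvalueP[v vl v0].
suff : sp X (a + c^-1 * l).
  rewrite Xa /= => /eqP; rewrite -subr_eq0 addrC addKr mulf_eq0 invr_eq0.
  by rewrite (negbTE c0) => /eqP.
apply/eigenvalueP; exists v => //.
apply/eqP; rewrite scalerDl -scalerA -vl -scalemxAr scalerA mulVf // scale1r.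
by rewrite mulmxBr mul_mx_scalar addrC subrK.
Qed.

(** The rescaled differences [Y k] and their squares have no eigenvalue but 0, so both traces vanish
    along the sequence, and by continuity at its limit [B]. *)
Lemma tangent_cone_scalar a B : (0 < n)%N -> tangent_cone a%:M B ->
  \tr B = 0 /\ \tr (B *m B) = 0.
Proof.
move=> n0 [X [c [XA _ c0 XB]]].
pose Y k := (c k)%:C%C *: (X k - a%:M).
have Y0 k : forall l, eigenvalue (Y k) l -> l = 0.
  apply: eigenvalue_scaled_shift.
    by rewrite (fmorph_eq0 (real_complex R)) gt_eqF.
  by rewrite (XA k).2 sp_scalar.
have closed0 (f : M -> C) : continuous f -> (forall k, f (Y k) = 0) -> f B = 0.
  move=> fc fY.
  have : (f \o Y) @ \oo --> f B by apply: continuous_cvg; [exact: fc|exact: XB].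
  have -> : f \o Y = cst 0 by apply/funext.
  by move=> /(cvg_lim (@norm_hausdorff _ _)) <-; rewrite lim_cst.
split.
  apply: (closed0 _ mxtrace_continuous) => k.
  (* Algebraic closedness is read off [R[i]], to which [Cplx R] unfolds. *)
  exact (mxtrace_eigenvalue0 R[i] _ (Y k) (Y0 k)).
apply: (closed0 _ mxtrace_sqr_continuous) => k.
apply: (mxtrace_eigenvalue0 R[i] _ (Y k *m Y k)).
exact (eigenvalue_sqr0 R[i] _ (Y k) (Y0 k)).
Qed.

End ScalarMatrix.

Theorem proposition4 (R : realType) (n : nat) (hn : (3 <= n)%N) :
  exists A : 'M[Cplx R]_n, spectral_ball A /\ tangent_cone A `<` Cstar A.
Proof.
have n0 : (0 < n)%N by apply: leq_trans hn.
(* Any nonzero number of modulus below 1 would do. *)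
pose a : Cplx R := (2^-1 : R)%:C%C.
have a0 : a != 0 by rewrite (fmorph_eq0 (real_complex R)) invr_eq0 pnatr_eq0.
exists a%:M; split.
  rewrite /spectral_ball /= /spectral_radius sp_scalar // image_set1 sup1.
  rewrite /= expr0n addr0 sqrtr_sqr ger0_norm ?invr_ge0 ?ler0n //.
  by rewrite invf_lt1 ?ltr1n.
split.
  move=> B /(tangent_cone_scalar _ _ n0)[trB _] j jn; apply/eqP.
  by rewrite lowest_part_sigma // trB.
pose i0 : 'I_n := Ordinal n0.
pose i1 : 'I_n := Ordinal (leq_trans (isT : (1 < 3)%N) hn).
pose B : 'M[Cplx R]_n := delta_mx i0 i0 - delta_mx i1 i1.
move=> /(_ B) CB; have /(tangent_cone_scalar _ _ n0)[_ /eqP] : tangent_cone a%:M B.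
  apply: CB => j jn; apply/eqP; rewrite lowest_part_sigma //.
  by rewrite /B raddfB /= !mxtrace_delta !eqxx subrr.
(* The mixed products vanish because [i0] and [i1] differ, and the two squares add up to trace 2. *)
rewrite /B mulmxBl !mulmxBr !mul_delta_mx_cond !eqxx !mulr0n !mulr1n.
rewrite subr0 sub0r opprK raddfD /= !mxtrace_delta !eqxx -natrD.
by rewrite pnatr_eq0.
Qed.
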